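(* Suppose that there is $r\in\mathbb N$ with $\operatorname{rank}\mathbb A(\xi)=r$ for all $\xi\in\mathbb R^d\setminus\{0\}$, and that the number of non-zero rows of $A^{(d)}$ equals the rank of $A^{(d)}$. Let $\varepsilon_j\downarrow0$ as $j\to\infty$. Then the symbols $\mathbb A_{\varepsilon_j}$ converge to the symbol $\tilde{\mathbb A}_0$ in the sense that $$\mathbb P_{\varepsilon_j}(\xi)\to\tilde{\mathbb P}_0(\xi)\quad\text{as }j\to\infty\qquad\text{for all }\xi\in\mathbb R^d.$$
   Context: Let $A^{(1)},\dots,A^{(d)}\in\mathbb R^{l\times m}$, $d\ge2$, and $\mathbb A(\xi)=\sum_{k=1}^dA^{(k)}\xi_k$ for $\xi\in\mathbb R^d$. For $\varepsilon>0$ put $\mathbb A_\varepsilon(\xi)=\sum_{k=1}^{d-1}A^{(k)}\xi_k+\frac1\varepsilon A^{(d)}\xi_d$, and let $\mathbb P_\varepsilon(\xi)\in\mathbb R^{m\times m}$ be the orthogonal projection of $\mathbb R^m$ onto $\ker\mathbb A_\varepsilon(\xi)$ (so $\mathbb P_\varepsilon(0)$ is the identity). With $[M]^i$ denoting the $i$th row of $M$, $\tilde{\mathbb A}_0(\xi)\in\mathbb R^{l\times m}$ is the matrix with rows $$[\tilde{\mathbb A}_0(\xi)]^i=\begin{cases}[A^{(d)}]^i\xi_d&\text{if }[A^{(d)}]^i\xi_d\ne0,\\ \sum_{k=1}^{d-1}[A^{(k)}]^i\xi_k&\text{if }[A^{(d)}]^i\xi_d=0,\end{cases}\qquad i=1,\dots,l,$$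 and $\tilde{\mathbb P}_0(\xi)$ is the orthogonal projection of $\mathbb R^m$ onto $\ker\tilde{\mathbb A}_0(\xi)$. *)

(* Defs.v *)
From HB Require Import structures.
From mathcomp Require Import all_boot all_order all_algebra.
From mathcomp Require Import all_classical all_reals all_analysis.

Set Implicit Arguments.
Unset Strict Implicit.
Unset Printing Implicit Defensive.

Import Order.TTheory GRing.Theory Num.Theory.
Import numFieldNormedType.Exports.

Local Open Scope ring_scope.

(* The d matrices A^(1), ..., A^(d) form a family A : 'I_n.+1 -> 'M[R]_(l, m)
   with d = n.+1; A^(d) is A ord_max and xi_k is the entry xi 0 k. *)
Section Symbols.
Context {R : realType} {l m n : nat}.
Implicit Types (A : 'I_n.+1 -> 'M[R]_(l, m)) (xi : 'rV[R]_n.+1) (eps : R).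

Definition symbol A xi : 'M[R]_(l, m) := \sum_k xi 0 k *: A k.

Definition symbol_eps A eps xi : 'M[R]_(l, m) :=
  \sum_(k | k != ord_max) xi 0 k *: A k
  + eps^-1 *: (xi 0 ord_max *: A ord_max).

Definition symbol_lim A xi : 'M[R]_(l, m) :=
  \matrix_(i < l)
    if xi 0 ord_max *: row i (A ord_max) != 0
    then xi 0 ord_max *: row i (A ord_max)
    else \sum_(k | k != ord_max) xi 0 k *: row i (A k).

Definition nonzero_rows (M : 'M[R]_(l, m)) : {set 'I_l} :=
  [set i | row i M != 0].

End Symbols.

Section KernelProjection.
Context {R : realType} {l m : nat}.
Implicit Types (M : 'M[R]_(l, m)) (P : 'M[R]_m) (x y : 'cV[R]_m).

(* MathComp's kermx and proj_mx act on row vectors: the rows of kermx M^T span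
   the (transposed) kernel of M in the space of column vectors, and kermx K^T is
   the orthogonal complement of the row space of K.  The outer transpose makes
   the projection act on column vectors by left multiplication.  (proj_ortho
   of MathComp is only available over a numClosedFieldType.) *)
Definition kerproj M : 'M[R]_m :=
  let K := kermx M^T in (proj_mx K (kermx K^T))^T.

Lemma mulmx_trmx_eq0 (u : 'rV[R]_m) : u *m u^T = 0 -> u = 0.
Proof.
move=> /matrixP/(_ 0 0); rewrite !mxE => /eqP.
rewrite psumr_eq0 => [/allP u0|j _]; last by rewrite mxE -expr2 sqr_ge0.
apply/rowP => j; rewrite mxE; have := u0 j (mem_index_enum j).
by rewrite mxE -expr2 sqrf_eq0 => /eqP.
Qed.

Lemma capmx_ortho (K : 'M[R]_m) : (K :&: kermx K^T = 0)%MS.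
Proof.
apply/eqP; rewrite -submx0; apply/row_subP => i; rewrite submx0.
set u := row i _; apply/eqP/mulmx_trmx_eq0.
have : (u <= K :&: kermx K^T)%MS by apply: row_sub.
rewrite sub_capmx => /andP[/submxP[D uE] /sub_kermxP uK].
by rewrite {2}uE trmx_mul mulmxA uK mul0mx.
Qed.

Lemma addsmx_ortho (K : 'M[R]_m) : row_full (K + kermx K^T)%MS.
Proof.
rewrite /row_full; have := mxrank_sum_cap K (kermx K^T).
rewrite capmx_ortho mxrank0 addn0 => ->.
by rewrite mxrank_ker mxrank_tr subnKC // rank_leq_row.
Qed.

(* kerproj M is the unique matrix P such that, for every x, P x lies in ker M
   and x - P x is orthogonal to ker M. *)
Lemma kerprojP M P :
  P = kerproj M <->
  (forall x, M *m (P *m x) = 0 /\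
             forall y, M *m y = 0 -> y^T *m (x - P *m x) = 0).
Proof.
have kpP x : M *m (kerproj M *m x) = 0 /\
    forall y, M *m y = 0 -> y^T *m (x - kerproj M *m x) = 0.
  rewrite /kerproj; set K := kermx M^T; set Q := proj_mx _ _.
  have KE : (K <= kermx M^T)%MS by [].
  split=> [|y My].
    have : (x^T *m Q <= kermx M^T)%MS by exact: proj_mx_sub.
    move=> /sub_kermxP/(congr1 trmx).
    by rewrite !trmx_mul !trmxK trmx0.
  have yK : (y^T <= K)%MS by apply/sub_kermxP; rewrite -trmx_mul My trmx0.
  have : (x^T - x^T *m Q <= kermx K^T)%MS.
    by apply: proj_mx_compl_sub; apply: submx_full; apply: addsmx_ortho.
  move=> /sub_kermxP/(congr1 trmx); rewrite trmx_mul trmxK linearB /= trmx_mul.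
  rewrite trmxK trmx0 => H.
  by case/submxP: yK => D ->; rewrite -mulmxA H mulmx0.
split=> [-> //|hP]; apply/matrixP => i j.
have [P1 P2] := hP (delta_mx j 0); have [Q1 Q2] := kpP (delta_mx j 0).
set x := delta_mx j 0 in P1 P2 Q1 Q2.
have Md : M *m (P *m x - kerproj M *m x) = 0 by rewrite mulmxBr P1 Q1 subrr.
have : (P *m x - kerproj M *m x)^T *m (P *m x - kerproj M *m x)^T^T = 0.
  have -> : (P *m x - kerproj M *m x)^T^T
      = (x - kerproj M *m x) - (x - P *m x).
    by rewrite trmxK opprB [in RHS]addrC addrA subrK.
  by rewrite mulmxBr P2 // Q2 // subrr.
move=> /mulmx_trmx_eq0/(congr1 trmx); rewrite trmxK trmx0 => /eqP.
rewrite subr_eq0 => /eqP; rewrite /x -!colE => /colP/(_ i).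
by rewrite !mxE.
Qed.

End KernelProjection.

(* Main.v *)
Require Import Defs.
From mathcomp Require Import all_boot all_order all_algebra.
From mathcomp Require Import all_classical all_reals all_analysis.

Import Order.TTheory GRing.Theory Num.Theory.
Import numFieldNormedType.Exports.

Local Open Scope classical_set_scope.
Local Open Scope ring_scope.

(** If xi_d = 0 the symbols at xi do not depend on eps and equal the limit
    symbol, so let xi_d <> 0.

    The symbol A_eps(xi) itself blows up as eps -> 0, but its kernel projection
    only sees its row space ([eqmx_kerproj]).  Multiplying by eps the rows of
    A_eps(xi) whose A^(d)-row is nonzero keeps the row space and yields matrices
    that do converge, precisely to the limit symbol ([cvg_rescaled_symbol]).

    Convergence of matrices does not imply convergence of the projections onto
    their kernels, since the kernel of the limit may be larger.  It does as soon
    as the rank does not drop in the limit ([cvg_kerproj]): independent rows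
    spanning the row space of the limit stay independent nearby, hence span the
    row space of the approximating matrices too, and for a matrix B with
    independent rows the projection is 1 - B^T (B B^T)^-1 B, which is continuous
    in B.

    That the rank does not drop is where the constant rank r enters.  Each
    A_eps(xi) is a value of the original symbol at a nonzero vector
    ([symbol_epsE]), so it has rank r.  The symbol at the d-th unit vector is
    A^(d), so A^(d) has rank r as well; and since xi_d <> 0 the limit symbol
    contains every nonzero row of A^(d) up to the factor xi_d, so its rank is at
    least r ([mxrank_symbol_lim]). *)

Section EntrywiseConvergence.
Set Implicit Arguments.
Unset Strict Implicit.
Context {K : numFieldType} {T : Type} {F : set_system T} {FF : Filter F}.

Lemma cvg_mxP (p q : nat) (M : T -> 'M[K]_(p, q)) (M0 : 'M[K]_(p, q)) :
  (M t @[t --> F] --> M0) <->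
  (forall i j, M t i j @[t --> F] --> M0 i j).
Proof.
split=> [MM0 i j|MM0].
  exact: (cvg_comp _ _ MM0 (@coord_continuous K p q i j M0)).
apply/cvg_mx_entourageP => E entE; near=> t => i j.
rewrite inE; move: i j; near: t.
apply: filter_forall => i; apply: filter_forall => j.
exact: ((cvg_entourageP _ _).1 (MM0 i j)).
Unshelve. all: by end_near. Qed.

Lemma cvg_mulmx (p q s : nat) (M : T -> 'M[K]_(p, q)) (N : T -> 'M[K]_(q, s))
    (M0 : 'M[K]_(p, q)) (N0 : 'M[K]_(q, s)) :
  M t @[t --> F] --> M0 -> N t @[t --> F] --> N0 ->
  M t *m N t @[t --> F] --> M0 *m N0.
Proof.
move=> /cvg_mxP MM0 /cvg_mxP NN0; apply/cvg_mxP => i j.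
rewrite mxE; under eq_cvg do rewrite mxE.
by apply: cvg_big => [|k _]; [exact: add_continuous | exact: cvgM].
Qed.

Lemma cvg_trmx (p q : nat) (M : T -> 'M[K]_(p, q)) (M0 : 'M[K]_(p, q)) :
  M t @[t --> F] --> M0 -> (M t)^T @[t --> F] --> M0^T.
Proof.
move=> /cvg_mxP MM0; apply/cvg_mxP => i j.
rewrite mxE; under eq_cvg do rewrite mxE.
exact: MM0.
Qed.

Lemma cvg_rowsub (p q s : nat) (f : 'I_s -> 'I_p) (M : T -> 'M[K]_(p, q))
    (M0 : 'M[K]_(p, q)) :
  M t @[t --> F] --> M0 -> rowsub f (M t) @[t --> F] --> rowsub f M0.
Proof.
move=> /cvg_mxP MM0; apply/cvg_mxP => i j.
rewrite mxE; under eq_cvg do rewrite mxE.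
exact: MM0.
Qed.

Lemma cvg_det (p : nat) (M : T -> 'M[K]_p) (M0 : 'M[K]_p) :
  M t @[t --> F] --> M0 -> \det (M t) @[t --> F] --> \det M0.
Proof.
move=> /cvg_mxP MM0; apply: cvg_big => [|s _]; first exact: add_continuous.
apply: cvgM; first exact: cvg_cst.
by apply: cvg_big => [|i _]; [exact: mul_continuous | exact: MM0].
Qed.

(** By Cramer's formula: determinant and adjugate are polynomial in the entries,
    and the determinant stays nonzero near an invertible limit. *)
Lemma cvg_invmx (p : nat) (M : T -> 'M[K]_p) (M0 : 'M[K]_p) :
  M0 \in unitmx -> M t @[t --> F] --> M0 ->
  invmx (M t) @[t --> F] --> invmx M0.
Proof.
move=> uM0 MM0; have dM0 : \det M0 != 0 by rewrite -unitfE -unitmxE.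
have detM := cvg_det MM0.
have adjM : \adj (M t) @[t --> F] --> \adj M0.
  apply/cvg_mxP => i j; rewrite mxE; under eq_cvg do rewrite mxE.
  apply: cvgM; first exact: cvg_cst.
  apply: cvg_det; apply/cvg_mxP => a b; rewrite !mxE.
  under eq_cvg do rewrite !mxE.
  by move/cvg_mxP : MM0; apply.
apply: (@cvg_trans _ ((\det (M t))^-1 *: \adj (M t) @[t --> F])).
  apply: near_eq_cvg; near=> t; rewrite /invmx ifT // unitmxE unitfE.
  by near: t; exact: cvgr_neq0 detM dM0.
rewrite /invmx uM0; apply/cvg_mxP => i j.
rewrite mxE; under eq_cvg do rewrite mxE.
by apply: cvgM; [exact: cvgV | move/cvg_mxP : adjM; apply].
Unshelve. all: by end_near. Qed.

End EntrywiseConvergence.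

Section KernelProjectionTheory.
Set Implicit Arguments.
Unset Strict Implicit.
Context {R : realType} {m : nat}.

(** The row space determines the kernel, being its orthogonal complement; the
    two matrices may have different numbers of rows. *)
Lemma eqmx_kerproj (p q : nat) (M : 'M[R]_(p, m)) (N : 'M[R]_(q, m)) :
  (M :=: N)%MS -> kerproj M = kerproj N.
Proof.
move=> MN.
have kerE (y : 'cV[R]_m) : M *m y = 0 <-> N *m y = 0.
  have [/submxP[C ->] /submxP[D ND]] : (M <= N)%MS /\ (N <= M)%MS.
    by rewrite !MN.
  split=> [My|Ny]; last by rewrite -mulmxA Ny mulmx0.
  by rewrite ND -mulmxA My mulmx0.
apply/kerprojP => x; have [/kerE Mx ortho] := (kerprojP M _).1 erefl x.
by split=> // y /kerE; exact: ortho.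
Qed.

(** If v B B^T = 0 then |v B|^2 = v B B^T v^T = 0.  This turns independence of
    the rows into the open condition that a determinant is nonzero. *)
Lemma row_free_gram (k : nat) (B : 'M[R]_(k, m)) :
  row_free B = (B *m B^T \in unitmx).
Proof.
rewrite -row_free_unit; apply/idP/idP => [freeB|].
  rewrite -kermx_eq0; apply/eqP/row_matrixP => i; rewrite row0.
  set v := row i _.
  have vBB : v *m (B *m B^T) = 0 by apply/sub_kermxP; exact: row_sub.
  apply: (row_free_inj freeB); rewrite mul0mx; apply: mulmx_trmx_eq0.
  by rewrite trmx_mul mulmxA -(mulmxA v) vBB mul0mx.
rewrite /row_free => /eqP rankBB; rewrite eqn_leq rank_leq_row -{1}rankBB.
exact: mxrankM_maxl.
Qed.

(** Subtracts the orthogonal projection onto the row space, in its normal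
    equations form. *)
Lemma kerproj_row_free (k : nat) (B : 'M[R]_(k, m)) : row_free B ->
  kerproj B = 1%:M - B^T *m invmx (B *m B^T) *m B.
Proof.
rewrite row_free_gram => uBB; symmetry; apply/kerprojP => x; split.
  by rewrite mulmxA mulmxBr mulmx1 !mulmxA mulmxV // mul1mx subrr mul0mx.
move=> y By; rewrite mulmxBl mul1mx opprB addrC subrK -!(mulmxA B^T) mulmxA.
by rewrite -trmx_mul By trmx0 mul0mx.
Qed.

(** The bound on the ranks cannot be dropped: the 1 x 1 matrices t <> 0 tend to 0 as
    t -> 0, while their kernel projections are 0 and that of the limit is 1. *)
Lemma cvg_kerproj (T : Type) (F : set_system T) (FF : Filter F) (l : nat)
    (M : T -> 'M[R]_(l, m)) (M0 : 'M[R]_(l, m)) :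
  M t @[t --> F] --> M0 ->
  (\forall t \near F, (\rank (M t) <= \rank M0)%N) ->
  kerproj (M t) @[t --> F] --> kerproj M0.
Proof.
move=> MM0 rankM; pose B t := rowsub (maxrankfun M0) (M t).
pose B0 := rowsub (maxrankfun M0) M0.
have freeB0 : row_free B0 by exact: maxrowsub_free.
have BB0 : B t @[t --> F] --> B0 by exact: cvg_rowsub.
have gramB : B t *m (B t)^T @[t --> F] --> B0 *m B0^T.
  by apply: cvg_mulmx => //; exact: cvg_trmx.
have uB0 : B0 *m B0^T \in unitmx by rewrite -row_free_gram.
have dB0 : \det (B0 *m B0^T) != 0 by rewrite -unitfE -unitmxE.
rewrite -(eqmx_kerproj (eq_maxrowsub M0)) (kerproj_row_free freeB0).
apply: (@cvg_trans _
  (1%:M - (B t)^T *m invmx (B t *m (B t)^T) *m B t @[t --> F])).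
  apply: near_eq_cvg; near=> t.
  have freeB : row_free (B t).
    rewrite row_free_gram unitmxE unitfE.
    by near: t; exact: cvgr_neq0 (cvg_det gramB) dB0.
  rewrite -(kerproj_row_free freeB); apply: eqmx_kerproj; apply/eqmxP.
  (* The selected rows are \rank M0 independent vectors in a row space of at
     most that dimension, so they span it. *)
  rewrite -(geq_leqif (mxrank_leqif_eq (rowsub_sub _ _))) (eqP freeB).
  by near: t.
have P : (B t)^T *m invmx (B t *m (B t)^T) *m B t @[t --> F]
    --> B0^T *m invmx (B0 *m B0^T) *m B0.
  apply: cvg_mulmx => //; apply: cvg_mulmx; first exact: cvg_trmx.
  exact: cvg_invmx.
apply/cvg_mxP => i j; rewrite mxE [X in _ + X]mxE.
under eq_cvg do rewrite mxE [X in _ + X]mxE.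
apply: cvgB; first exact: cvg_cst.
by move/cvg_mxP : P; apply.
Unshelve. all: by end_near. Qed.

End KernelProjectionTheory.

Section Rescaling.
Set Implicit Arguments.
Unset Strict Implicit.
Context {R : realType} {l m n : nat} (A : 'I_n.+1 -> 'M[R]_(l, m)).

Definition rescaled_symbol (eps : R) (xi : 'rV[R]_n.+1) : 'M[R]_(l, m) :=
  diag_mx (\row_i if i \in nonzero_rows (A ord_max) then eps else 1)
    *m symbol_eps A eps xi.

Lemma eqmx_rescaled_symbol (eps : R) (xi : 'rV[R]_n.+1) : eps != 0 ->
  (rescaled_symbol eps xi :=: symbol_eps A eps xi)%MS.
Proof.
move=> eps0; apply: eqmxMfull; rewrite row_full_unit unitmxE det_diag unitfE.
by apply/prodf_neq0 => i _; rewrite mxE; case: ifP; rewrite ?oner_neq0.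
Qed.

(** Row i is eps S_i + xi_d A^(d)_i if A^(d)_i <> 0, where the factor eps cancels
    the 1/eps, and is S_i otherwise, with S the part of the symbol at xi coming
    from the first d - 1 directions. *)
Lemma cvg_rescaled_symbol (T : Type) (F : set_system T) (FF : Filter F)
    (eps : T -> R) (xi : 'rV[R]_n.+1) :
  xi 0 ord_max != 0 -> (forall t, eps t != 0) -> eps t @[t --> F] --> (0 : R) ->
  rescaled_symbol (eps t) xi @[t --> F] --> symbol_lim A xi.
Proof.
move=> xid epsn0 eps0; apply/cvg_mxP => i j.
rewrite mxE scaler_eq0 negb_or xid /=.
have rowE : (i \in nonzero_rows (A ord_max)) = (row i (A ord_max) != 0).
  by rewrite inE.
set S := \sum_(k | k != ord_max) xi 0 k *: A k.
have scaledE t : rescaled_symbol (eps t) xi i j =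
    (if i \in nonzero_rows (A ord_max)
     then eps t * S i j + xi 0 ord_max * A ord_max i j else S i j).
  rewrite /rescaled_symbol mul_diag_mx mxE [X in X * _]mxE /symbol_eps -/S.
  rewrite [X in _ * X]mxE [X in _ * (_ + X)]mxE [X in _ * (_ + _ * X)]mxE.
  case: ifPn => [_|]; first by rewrite mulrDr mulVKf.
  rewrite rowE negbK => /eqP/rowP/(_ j); rewrite !mxE => ->.
  by rewrite !mulr0 addr0 mul1r.
under eq_cvg do rewrite scaledE.
rewrite rowE; case: ifP => _.
  have -> : (xi 0 ord_max *: row i (A ord_max)) 0 j
      = 0 * S i j + xi 0 ord_max * A ord_max i j.
    by rewrite mul0r add0r !mxE.
  by apply: cvgD; [apply: cvgM => //; exact: cvg_cst | exact: cvg_cst].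
have -> : (\sum_(k | k != ord_max) xi 0 k *: row i (A k)) 0 j = S i j.
  by rewrite !summxE; apply: eq_bigr => k _; rewrite !mxE.
exact: cvg_cst.
Qed.

Lemma mxrank_symbol_lim (xi : 'rV[R]_n.+1) : xi 0 ord_max != 0 ->
  (\rank (A ord_max) <= \rank (symbol_lim A xi))%N.
Proof.
move=> xid; apply: mxrankS; apply/row_subP => i.
have [->|rown0] := eqVneq (row i (A ord_max)) 0; first exact: sub0mx.
rewrite -(eqmx_scale _ xid); have <- : row i (symbol_lim A xi)
    = xi 0 ord_max *: row i (A ord_max).
  by rewrite rowK scaler_eq0 negb_or xid rown0.
exact: row_sub.
Qed.

(** Rescaling the last direction of the symbol amounts to rescaling the last
    coordinate of its argument. *)
Lemma symbol_epsE (eps : R) (xi : 'rV[R]_n.+1) :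
  symbol_eps A eps xi =
  symbol A (\row_k if k == ord_max then eps^-1 * xi 0 k else xi 0 k).
Proof.
rewrite /symbol_eps /symbol [RHS](bigD1 ord_max) //= mxE eqxx scalerA addrC.
by congr (_ + _); apply: eq_bigr => k /negPf kd; rewrite mxE kd.
Qed.

Lemma symbol_eps_lim_last0 (eps : R) (xi : 'rV[R]_n.+1) : xi 0 ord_max = 0 ->
  symbol_eps A eps xi = symbol_lim A xi.
Proof.
move=> xid; apply/row_matrixP => i.
rewrite rowK xid scale0r eqxx /= /symbol_eps xid scale0r scaler0 addr0.
by rewrite linear_sum; apply: eq_bigr => k _; rewrite linearZ.
Qed.

End Rescaling.

Theorem lemma4p3 (R : realType) (l m n : nat) (hd : (2 <= n.+1)%N)
  (A : 'I_n.+1 -> 'M[R]_(l, m))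
  (hrank : exists r : nat,
    forall xi : 'rV[R]_n.+1, xi != 0 -> \rank (symbol A xi) = r)
  (hrows : #|nonzero_rows (A ord_max)| = \rank (A ord_max))
  (eps : nat -> R)
  (eps_gt0 : forall j, 0 < eps j)
  (eps_decr : nonincreasing_seq eps)
  (eps_cvg0 : eps j @[j --> \oo] --> (0 : R)) :
  forall xi : 'rV[R]_n.+1,
    kerproj (symbol_eps A (eps j) xi) @[j --> \oo]
      --> kerproj (symbol_lim A xi).
Proof.
move=> xi; have [xid|xid] := eqVneq (xi 0 ord_max) 0.
  under eq_cvg do rewrite (symbol_eps_lim_last0 A _ xid).
  exact: cvg_cst.
have epsn0 j : eps j != 0 by rewrite gt_eqF.
have [r rankA] := hrank.
have rank_eps j : \rank (symbol_eps A (eps j) xi) = r.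
  rewrite symbol_epsE rankA //; apply: contra_neq xid => /rowP/(_ ord_max).
  rewrite !mxE eqxx => /eqP.
  by rewrite mulf_eq0 invr_eq0 (negPf (epsn0 j)) => /eqP.
have rank_max : \rank (A ord_max) = r.
  have <- : symbol A (delta_mx 0 ord_max) = A ord_max.
    rewrite /symbol (bigD1 ord_max) //= big1 ?addr0 => [|k /negPf kd].
      by rewrite mxE !eqxx scale1r.
    by rewrite mxE kd andbF scale0r.
  apply: rankA; apply/eqP => /rowP/(_ ord_max)/eqP.
  by rewrite !mxE !eqxx oner_eq0.
under eq_cvg => j do
  rewrite -(eqmx_kerproj (eqmx_rescaled_symbol A xi (epsn0 j))).
apply: cvg_kerproj; first exact: cvg_rescaled_symbol.
apply: nearW => j; rewrite (eqmx_rescaled_symbol A xi (epsn0 j)) rank_eps.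
by rewrite -rank_max; exact: mxrank_symbol_lim.
Qed.
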